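(* Let $\mathbb{K}$ be a field with algebraic closure $\overline{\mathbb{K}}$, let $n\ge 1$, let $T\in \mathrm{GL}(n,\mathbb{K})$, and let $\mathcal{C}_{\overline{\mathbb{K}}}:=\{A\in \mathrm{GL}(n,\overline{\mathbb{K}})\mid AT=TA\}$. Eigenvalues and Jordan blocks of $T$ are taken over $\overline{\mathbb{K}}$. (a) If $T$ has a unique Jordan block for every eigenvalue, then $\mathcal{C}_{\overline{\mathbb{K}}}$ is abelian. (b) If $T$ has two Jordan blocks of the same size for the same eigenvalue, then $\mathcal{C}_{\overline{\mathbb{K}}}$ contains a copy of $\mathrm{GL}(2,\overline{\mathbb{K}})$, i.e. a subgroup isomorphic to $\mathrm{GL}(2,\overline{\mathbb{K}})$. (c) If, for each eigenvalue, the Jordan blocks of $T$ for that eigenvalue (there may be one or more) have pairwise different sizes, and at least one eigenvalue has at least two Jordan blocks, then $\mathcal{C}_{\overline{\mathbb{K}}}$ is a non-abelian solvable group.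
   Context: The Jordan blocks of $T$ are the blocks, counted with multiplicity, in its Jordan normal form over $\overline{\mathbb{K}}$. *)

(* Defs.v *)
From HB Require Import structures.
From mathcomp Require Import all_boot all_order all_fingroup all_algebra.

Set Implicit Arguments.
Unset Strict Implicit.
Unset Printing Implicit Defensive.

Import GRing.Theory.
Local Open Scope ring_scope.

(* The library's {'GL_n[R]} is restricted to finite rings, and its group
   notions to subgroups of a finGroupType, hence the versions below over the
   possibly infinite groups of type groupType. *)

Section GL.
Variables (F : fieldType) (n : nat).

Record GL := MkGL { GL_mx :> 'M[F]_n; GL_unit : GL_mx \in unitmx }.

HB.instance Definition _ := [isSub for GL_mx].
HB.instance Definition _ := [Choice of GL by <:].

Implicit Types A B C : GL.

Fact GL_mul_unit A B : GL_mx A *m GL_mx B \in unitmx.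
Proof. by rewrite unitmx_mul !GL_unit. Qed.
Fact GL_inv_unit A : invmx (GL_mx A) \in unitmx.
Proof. by rewrite unitmx_inv GL_unit. Qed.

Definition GL_one : GL := MkGL (unitmx1 F n).
Definition GL_mul A B : GL := MkGL (GL_mul_unit A B).
Definition GL_inv A : GL := MkGL (GL_inv_unit A).

Fact GL_mulA : associative GL_mul.
Proof. by move=> A B C; apply/val_inj/mulmxA. Qed.
Fact GL_mul1 : left_id GL_one GL_mul.
Proof. by move=> A; apply/val_inj/mul1mx. Qed.
Fact GL_mul1r : right_id GL_one GL_mul.
Proof. by move=> A; apply/val_inj/mulmx1. Qed.
Fact GL_mulV : left_inverse GL_one GL_inv GL_mul.
Proof. by move=> A; apply/val_inj/mulVmx/GL_unit. Qed.
Fact GL_mulVr : right_inverse GL_one GL_inv GL_mul.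
Proof. by move=> A; apply/val_inj/mulmxV/GL_unit. Qed.

HB.instance Definition _ :=
  isGroup.Build GL GL_mulA GL_mul1 GL_mul1r GL_mulV GL_mulVr.

Variable T : 'M[F]_n.

Definition GL_commutes : pred GL := [pred A : GL | A *m T == T *m A].

Fact GL_commutes_group_closed : group_closed GL_commutes.
Proof.
split=> [|A B]; rewrite !inE; first by rewrite mul1mx mulmx1.
move=> /eqP cA /eqP cB; apply/eqP; rewrite /= -mulmxA.
suff -> : invmx B *m T = T *m invmx B by rewrite !mulmxA cA.
by rewrite -[LHS](mulmxK (GL_unit B)) -(mulmxA (invmx B)) -cB mulKmx ?GL_unit.
Qed.

Definition GL_centralizer : Type := {A : GL | GL_commutes A}.

HB.instance Definition _ := SubChoice.on GL_centralizer.
HB.instance Definition _ :=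
  SubChoice_isSubGroup.Build GL GL_commutes GL_centralizer
    GL_commutes_group_closed.

End GL.

Section Groups.
Local Open Scope group_scope.

Definition is_abelian (G : groupType) : Prop := forall x y : G, commute x y.

Definition is_subgroup (G : groupType) (H : G -> Prop) : Prop :=
  [/\ H 1, forall x y, H x -> H y -> H (x * y) & forall x, H x -> H x^-1].

Definition generated (G : groupType) (S : G -> Prop) (x : G) : Prop :=
  forall H, is_subgroup H -> (forall y, S y -> H y) -> H x.

Definition derived_subgroup (G : groupType) (H : G -> Prop) : G -> Prop :=
  generated (fun z => exists x y, [/\ H x, H y & z = [~ x, y]]).

Definition derived_series (G : groupType) (k : nat) : G -> Prop :=
  iter k (@derived_subgroup G) (fun=> True).

Definition is_solvable (G : groupType) : Prop :=
  exists k, forall x : G, derived_series k x -> x = 1.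

Definition contains_copy (G G' : groupType) : Prop :=
  exists2 H : G -> Prop, is_subgroup H &
    exists f : {multiplicative G' -> G},
      injective f /\ (forall y, H y <-> exists x, f x = y).

End Groups.

Section Jordan.
Variable F : fieldType.

Definition jordan_block (a : F) (m : nat) : 'M[F]_m :=
  \matrix_(i, j) (if i == j then a else (j == i.+1 :> nat)%:R).

Definition jordan_mx r (ev : 'I_r -> F) (sz : 'I_r -> nat) :
    'M[F]_(\sum_(i < r) sz i) :=
  \mxdiag_(i < r) jordan_block (ev i) (sz i).

(* The Jordan blocks of A, counted with multiplicity, are indexed by 'I_r:
   block i has eigenvalue ev i and size sz i. *)
Definition jordan_form n (A : 'M[F]_n) r (ev : 'I_r -> F) (sz : 'I_r -> nat) :
    Prop :=
  (forall i, 0 < sz i)%N /\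
  exists e : (\sum_(i < r) sz i)%N = n,
    similar_in unitmx A (castmx (e, e) (jordan_mx ev sz)).

End Jordan.

(* Main.v *)
Require Import Defs.
From HB Require Import structures.
From mathcomp Require Import all_boot all_order all_fingroup all_algebra.
From mathcomp Require Import zify.

(* Write X, commuting with the Jordan matrix J, in blocks X_ij; each X_ij
   intertwines two Jordan blocks, so it vanishes for distinct eigenvalues and is
   otherwise an upper triangular Toeplitz matrix, flush with the top right
   corner.
   (a) Only the diagonal blocks X_ii survive, and each is a polynomial in the
   corresponding nilpotent block.
   (b) Identity matrices placed at the four positions (i, i), (i, j), (j, i),
   (j, j) of two equal blocks form a system of 2 x 2 matrix units commuting with
   J.
   (c) Weight the k-th basis vector of block i by k - (sz i - k). An entry of X
   between two distinct basis vectors is zero unless the weight strictly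
   increases, since the sizes for a given eigenvalue differ. So the commutant is
   triangular for this weight, and the derived series is contained in ever
   smaller congruence subgroups. For two blocks i, j with the same eigenvalue,
   the intertwiner Z whose only nonzero entry is the top right entry of its
   block (i, j), and the projection E on block i, satisfy EZ = Z and ZE = 0,
   hence 1 + Z and 1 + cE do not commute. *)

Set Implicit Arguments.
Unset Strict Implicit.
Unset Printing Implicit Defensive.

Import GRing.Theory.
Local Open Scope ring_scope.

Lemma comm_mxZ (R : comPzSemiRingType) n (c : R) (A B : 'M_n) :
  comm_mx A B -> comm_mx A (c *: B).
Proof. by rewrite /comm_mx -scalemxAl -scalemxAr => ->. Qed.

(** * Intertwiners of two Jordan blocks *)

Section JordanBlockCommutant.
Variable F : fieldType.

(** The sum has at most one term; writing it as a sum makes it 0 when [k] is the last row, with no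
    side condition on the index. *)
Lemma mul_jordan_block_mx (a : F) m m' (X : 'M_(m, m')) k l :
  (jordan_block a m *m X) k l =
    a * X k l + \sum_(k' < m | k' == k.+1 :> nat) X k' l.
Proof.
rewrite mxE (bigD1 k) //= mxE eqxx; congr (_ + _).
rewrite big_mkcond [RHS]big_mkcond; apply: eq_bigr => i _ /=.
rewrite mxE eq_sym; case: eqVneq => [->|_] /=; first by case: eqP => //; lia.
by case: eqP; rewrite ?mul1r ?mul0r.
Qed.

Lemma mul_mx_jordan_block (b : F) m m' (X : 'M_(m, m')) k l :
  (X *m jordan_block b m') k l =
    X k l * b + \sum_(l' < m' | l == l'.+1 :> nat) X k l'.
Proof.
rewrite mxE (bigD1 l) //= mxE eqxx; congr (_ + _).
rewrite big_mkcond [RHS]big_mkcond; apply: eq_bigr => i _ /=.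
rewrite mxE; case: eqVneq => [->|_] /=; first by case: eqP => //; lia.
by case: eqP; rewrite ?mulr1 ?mulr0.
Qed.

(** Entrywise, (a - b) X_kl = X_(k,l-1) - X_(k+1,l), with 0 outside the matrix. Both entries on the
    right are closer to the bottom left corner, which gives the induction on [l + (m - k)]. *)
Lemma intertwiner_eq0 (a b : F) m m' (X : 'M_(m, m')) :
  a != b -> jordan_block a m *m X = X *m jordan_block b m' -> X = 0.
Proof.
move=> neq_ab /matrixP eqX; apply/matrixP => k l; rewrite mxE.
have [s] := ubnP (l + (m - k)); elim: s k l => // s IHs k l lt_s.
move: (eqX k l); rewrite mul_jordan_block_mx mul_mx_jordan_block.
rewrite !big1 => [|l' /eqP ? | k' /eqP ?].
- rewrite !addr0 mulrC => /eqP; rewrite -subr_eq0 -mulrBr mulf_eq0.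
  by rewrite subr_eq0 (negPf neq_ab) orbF => /eqP.
- by apply: IHs; lia.
- by apply: IHs; move: (ltn_ord k'); lia.
Qed.

Section SameEigenvalue.
Variables (a : F) (m m' : nat) (X : 'M[F]_(m, m')).
Hypothesis eqX : jordan_block a m *m X = X *m jordan_block a m'.

(** The diagonal terms cancel, which leaves the Toeplitz relation X_(k+1,l) = X_(k,l-1), with 0
    outside the matrix. *)
Lemma intertwiner_shift (k : 'I_m) (l : 'I_m') :
  \sum_(k' < m | k' == k.+1 :> nat) X k' l =
  \sum_(l' < m' | l == l'.+1 :> nat) X k l'.
Proof.
have /matrixP/(_ k l) := eqX.
by rewrite mul_jordan_block_mx mul_mx_jordan_block mulrC => /addrI.
Qed.

Lemma intertwiner_shiftS (k k' : 'I_m) l :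
  k' = k.+1 :> nat -> X k' l = \sum_(l' < m' | l == l'.+1 :> nat) X k l'.
Proof.
by move=> k'E; rewrite -intertwiner_shift (big_pred1 k') // => i; rewrite -k'E.
Qed.

(* Nonzero diagonals of X start on its top row and end on its last column. *)
Lemma intertwiner_support k l :
  X k l != 0 -> (k <= l)%N /\ (m' - l <= m - k)%N.
Proof.
split; rewrite leqNgt; apply: contraNN H => lt_; apply/eqP.
(* Move up and left along the diagonal until it leaves through the first column. *)
- have [s] := ubnP (nat_of_ord l); elim: s k l lt_ => // s IHs k l lt_lk lt_s.
  have lt_k1 : (k.-1 < m)%N by apply: leq_ltn_trans (leq_pred _) _.
  rewrite (@intertwiner_shiftS (Ordinal lt_k1)) /=; last by lia.
  by rewrite big1 // => l' /eqP lE; apply: IHs => /=; lia.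
(* Move down and right until the diagonal leaves through the last row. *)
have [s] := ubnP (m - k); elim: s k l lt_ => // s IHs k l lt_kl lt_s.
have lt_l1 : (l.+1 < m')%N by move: (ltn_ord k); lia.
have := intertwiner_shift k (Ordinal lt_l1).
rewrite [RHS](big_pred1 l) => [<-|l' /=]; last by rewrite eqSS eq_sym.
by rewrite big1 // => k' /eqP kE; apply: IHs => /=; move: (ltn_ord k'); lia.
Qed.

End SameEigenvalue.

Lemma comm_jordan_block_row0 (a : F) m (X : 'M_m.+1) :
  jordan_block a m.+1 *m X = X *m jordan_block a m.+1 -> row 0 X = 0 -> X = 0.
Proof.
move=> eqX /rowP X0; apply/matrixP => k l; rewrite mxE.
case: k => k lt_k; elim: k lt_k l => [|k IHk] lt_k l.
  have := X0 l; rewrite !mxE => <-; congr (X _ _); exact: val_inj.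
rewrite (intertwiner_shiftS eqX (k := Ordinal (ltnW lt_k))) //.
by rewrite big1.
Qed.

Lemma row0_jordan_block0X m c (l : 'I_m.+1) :
  (jordan_block (0 : F) m.+1 ^+ c) 0 l = (l == c :> nat)%:R.
Proof.
elim: c l => [|c IHc] l; first by rewrite expr0 mxE eq_sym.
rewrite exprSr mul_mx_jordan_block mulr0 add0r.
under eq_bigr do rewrite IHc.
case: (unliftP ord0 l) => [l'|] ->; last by rewrite big_pred0.
have lt_l : (l' < m.+1)%N by move: (ltn_ord l'); lia.
rewrite (big_pred1 (Ordinal lt_l)) /= => [|i /=]; rewrite /bump /= add1n eqSS //.
by rewrite eq_sym.
Qed.

Lemma jordan_blockE (a : F) m : jordan_block a m = a%:M + jordan_block 0 m.
Proof.
apply/matrixP => i j; rewrite !mxE; case: eqVneq => _; first by rewrite addr0.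
by rewrite mulr0n add0r.
Qed.

Lemma comm_jordan_block (a : F) m (X : 'M_m) :
  comm_mx (jordan_block a m) X -> comm_mx (jordan_block 0 m) X.
Proof.
rewrite /comm_mx [jordan_block a m]jordan_blockE mulmxDl mulmxDr.
by rewrite scalar_mxC => /addrI.
Qed.

(* The first basis vector is cyclic for jordan_block 0 m, hence X is a
   polynomial in jordan_block 0 m. *)
Lemma comm_comm_jordan_block (a : F) m (X Y : 'M_m) :
  comm_mx (jordan_block a m) X -> comm_mx (jordan_block a m) Y -> comm_mx X Y.
Proof.
case: m X Y => [|m] X Y /comm_jordan_block cX /comm_jordan_block cY.
  by apply/matrixP => -[].
(* The coefficients are read off the top row of [X], since the top row of the [c]-th power is the
   [c]-th basis vector. The difference of the two sides then commutes with the block and has zero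
   top row. *)
suff -> : X = \sum_(c < m.+1) X 0 c *: jordan_block (0 : F) m.+1 ^+ c.
  apply/comm_mx_sym/comm_mx_sum => c _; apply/comm_mxZ.
  by apply: (@commrX _ Y); exact: comm_mx_sym.
apply/eqP; rewrite -subr_eq0; apply/eqP; apply: (@comm_jordan_block_row0 0).
  apply: comm_mxB => //; apply/comm_mx_sum => c _; apply/comm_mxZ.
  exact: (@commrX _ (jordan_block (0 : F) m.+1)).
apply/rowP => l; rewrite !mxE summxE (bigD1 l) //= big1 => [|c neq_cl].
  by rewrite mxE row0_jordan_block0X eqxx mulr1 addr0 subrr.
by rewrite mxE row0_jordan_block0X val_eqE eq_sym (negPf neq_cl) mulr0.
Qed.

Lemma jordan_block_pid_mx (a : F) m p q :
  p = m -> q = m ->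
  jordan_block a p *m (pid_mx m : 'M_(p, q)) = pid_mx m *m jordan_block a q.
Proof. by move=> -> ->; rewrite pid_mx_1 mulmx1 mul1mx. Qed.

(** For positive sizes, this is a right eigenvector of the block of size [m] times a left
    eigenvector of the block of size [m'], hence an intertwiner when the eigenvalues agree. *)
Definition corner_mx m m' : 'M[F]_(m, m') :=
  \matrix_(p, q) ((p == 0%N :> nat) && (q.+1 == m'))%:R.

Lemma mul_jordan_block_corner (a : F) m m' :
  jordan_block a m *m corner_mx m m' = a *: corner_mx m m'.
Proof.
apply/matrixP => p q; rewrite mul_jordan_block_mx big1 => [|p' /eqP p'E].
  by rewrite addr0 [RHS]mxE.
by rewrite mxE p'E.
Qed.

Lemma mul_corner_jordan_block (b : F) m m' :
  corner_mx m m' *m jordan_block b m' = b *: corner_mx m m'.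
Proof.
apply/matrixP => p q; rewrite mul_mx_jordan_block big1 => [|q' /eqP qE].
  by rewrite addr0 [RHS]mxE mulrC.
by rewrite mxE -qE (ltn_eqF (ltn_ord q)) andbF.
Qed.

End JordanBlockCommutant.

(** * The commutant of a Jordan matrix *)

Section JordanMxCommutant.
Variables (F : fieldType) (r : nat) (ev : 'I_r -> F) (sz : 'I_r -> nat).
Local Notation J := (jordan_mx ev sz).

Lemma comm_jordan_mxP X :
  comm_mx J X <->
  forall i j, jordan_block (ev i) (sz i) *m submxblock X i j =
              submxblock X i j *m jordan_block (ev j) (sz j).
Proof.
rewrite /comm_mx -{1 2}[X]submxblockK /jordan_mx.
by rewrite mul_mxdiag_mxblock mul_mxblock_mxdiag eq_mxblockP.
Qed.

Lemma mul_mxdiag (A B : forall i, 'M[F]_(sz i)) :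
  \mxdiag_i A i *m \mxdiag_i B i = \mxdiag_i (A i *m B i).
Proof.
rewrite [X in _ *m X]/mxdiag mul_mxdiag_mxblock; apply: eq_mxblock => i j.
by case: eqVneq => [<-|_]; rewrite ?conform_mx_id ?mulmx0.
Qed.

Lemma comm_comm_jordan_mx X Y :
  injective ev -> comm_mx J X -> comm_mx J Y -> comm_mx X Y.
Proof.
move=> ev_inj.
have diagE Z : comm_mx J Z -> Z = \mxdiag_i submxblock Z i i.
  move=> /comm_jordan_mxP cZ; rewrite -[LHS]submxblockK; apply: eq_mxblock.
  move=> i j; case: eqVneq => [<-|neq_ij]; first by rewrite conform_mx_id.
  by apply: intertwiner_eq0 (cZ i j); rewrite (inj_eq ev_inj).
move=> cX cY; rewrite (diagE X) // (diagE Y) // /comm_mx !mul_mxdiag.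
apply: eq_mxdiag => i; apply: (@comm_comm_jordan_block _ (ev i)).
  exact: (comm_jordan_mxP X).1.
exact: (comm_jordan_mxP Y).1.
Qed.

(* (k - (sz i - k)) for the k-th basis vector of block i, shifted by the
   constant \sum_i sz i so as to be a natural number. *)
Definition jordan_weight (p : 'I_(\sum_i sz i)) : nat :=
  (tagnat.sig2 p + (\sum_i sz i - (sz (tagnat.sig1 p) - tagnat.sig2 p)))%N.

Lemma comm_jordan_mx_weight X p q :
  (forall i j, i != j -> ev i = ev j -> sz i <> sz j) ->
  comm_mx J X -> X p q != 0 ->
  p = q \/ (jordan_weight p < jordan_weight q)%N.
Proof.
move=> neq_sz /comm_jordan_mxP cX nz_pq.
set i := tagnat.sig1 p; set j := tagnat.sig1 q.
have {}nz_pq : submxblock X i j (tagnat.sig2 p) (tagnat.sig2 q) != 0.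
  by rewrite mxE !tagnat.sig2K.
have eq_ev : ev i = ev j.
  apply/eqP; apply: contraNT nz_pq => neq_ev.
  by rewrite (intertwiner_eq0 neq_ev (cX i j)) mxE.
have := cX i j; rewrite -eq_ev => /intertwiner_support/(_ _ _ nz_pq)[le1 le2].
have le_sz k : (sz k <= \sum_i sz i)%N by rewrite (bigD1 k) //= leq_addr.
have [eq_pq|neq_pq] := eqVneq p q; [by left | right].
(* The support inequalities make the weight weakly increase; equality would force k = l and s = t.
   The bounds by [S] keep the truncated subtractions exact. *)
have ltS (S k l s t : nat) : (k <= l)%N -> (t - l <= s - k)%N ->
    (s <= S)%N -> (t <= S)%N -> (k < s)%N -> (l < t)%N -> (s = t -> k <> l) ->
    (k + (S - (s - k)) < l + (S - (t - l)))%N by lia.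
apply: ltS => // eq_sz eq_pq; move/eqP: neq_pq; apply.
have ij : i == j by apply/contraT => /neq_sz-/(_ eq_ev eq_sz).
apply/val_inj/eqP; rewrite /= -[p]tagnat.sig2K -[q]tagnat.sig2K tagnat.eq_Rank.
by rewrite ij; apply/eqP.
Qed.

(** [pid_mx m] serves as the identity between blocks whose sizes are equal only propositionally,
    which avoids casts. *)
Definition jordan_unit m i j : 'M[F]_(\sum_i sz i) :=
  \mxblock_(k, l) (((k == i) && (l == j))%:R *: pid_mx m).

Lemma mul_jordan_unit m i j k l :
  sz j = m ->
  jordan_unit m i j *m jordan_unit m k l = (j == k)%:R *: jordan_unit m i l.
Proof.
move=> szj; rewrite mul_mxblock.
have termE x y z : ((x == i) && (z == j))%:R *: (pid_mx m : 'M[F]_(sz x, sz z))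
      *m (((z == k) && (y == l))%:R *: pid_mx m) =
    if z == j then ((j == k) && (x == i) && (y == l))%:R *: pid_mx m else 0.
  rewrite -scalemxAl -scalemxAr scalerA -natrM mulnb.
  case: (eqVneq z j) => [->|_]; last by rewrite andbF scale0r.
  (* The middle block has size exactly [m], so no rank is lost in the product. *)
  rewrite mul_pid_mx szj !minnn andbT; congr (_%:R *: _).
  by case: (x == i); case: (j == k); case: (y == l).
have -> : \mxblock_(x, y) \sum_z ((x == i) && (z == j))%:R *:
      (pid_mx m : 'M[F]_(sz x, sz z)) *m
      (((z == k) && (y == l))%:R *: (pid_mx m : 'M_(sz z, sz y))) =
    \mxblock_(x, y) (((j == k) && (x == i) && (y == l))%:R *: pid_mx m).
  apply: eq_mxblock => x y; under eq_bigr do rewrite termE.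
  by rewrite -big_mkcond big_pred1_eq.
case: (j == k); rewrite /= ?scale1r // scale0r -[RHS]mxblock0.
by apply: eq_mxblock => x y; rewrite scale0r.
Qed.

Lemma comm_jordan_unit m i j :
  sz i = m -> sz j = m -> ev i = ev j -> comm_mx J (jordan_unit m i j).
Proof.
move=> szi szj eq_ev; apply/comm_jordan_mxP => k l; rewrite mxblockK.
case: eqVneq => [->|_]; last by rewrite scale0r mulmx0 mul0mx.
case: eqVneq => [->|_]; last by rewrite scale0r mulmx0 mul0mx.
by rewrite !scale1r eq_ev jordan_block_pid_mx.
Qed.

Lemma jordan_unit_neq0 m i j :
  (0 < m)%N -> sz i = m -> sz j = m -> jordan_unit m i j != 0.
Proof.
move=> m_gt0 szi szj; have lti : (0 < sz i)%N by rewrite szi.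
have ltj : (0 < sz j)%N by rewrite szj.
apply: contra_neq (oner_neq0 F).
move=> /(congr1 (fun M => submxblock M i j (Ordinal lti) (Ordinal ltj))).
by rewrite mxblockK submxblock0 !mxE !eqxx /= m_gt0 mulr1.
Qed.

Definition jordan_corner i j : 'M[F]_(\sum_i sz i) :=
  \mxblock_(k, l) (((k == i) && (l == j))%:R *: corner_mx F (sz k) (sz l)).

Lemma jordan_corner_neq0 i j :
  (0 < sz i)%N -> (0 < sz j)%N -> jordan_corner i j != 0.
Proof.
move=> lti ltj; have ltj' : ((sz j).-1 < sz j)%N by rewrite prednK.
apply: contra_neq (oner_neq0 F).
move=> /(congr1 (fun M => submxblock M i j (Ordinal lti) (Ordinal ltj'))).
by rewrite mxblockK submxblock0 !mxE !eqxx /= prednK ?eqxx // mulr1.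
Qed.

Lemma submxblockZ c (M : 'M[F]_(\sum_i sz i)) i j :
  submxblock (c *: M) i j = c *: submxblock M i j.
Proof. by apply/matrixP => p q; rewrite !mxE. Qed.

Lemma mul_jordan_mx_corner i j :
  J *m jordan_corner i j = ev i *: jordan_corner i j.
Proof.
apply/mxblockP => k l; rewrite mul_mxdiag_mxblock submxblockZ !mxblockK.
case: eqVneq => [->|_]; last by rewrite scale0r scaler0 mulmx0.
by rewrite -scalemxAr mul_jordan_block_corner scalerA mulrC -scalerA.
Qed.

Lemma mul_corner_jordan_mx i j :
  jordan_corner i j *m J = ev j *: jordan_corner i j.
Proof.
apply/mxblockP => k l; rewrite mul_mxblock_mxdiag submxblockZ !mxblockK.
case: (eqVneq l j) => [->|_]; last by rewrite andbF scale0r scaler0 mul0mx.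
by rewrite -scalemxAl mul_corner_jordan_block scalerA mulrC -scalerA.
Qed.

Lemma mul_jordan_unit_corner i j k :
  jordan_unit (sz i) i i *m jordan_corner j k = (i == j)%:R *: jordan_corner j k.
Proof.
have unitE : jordan_unit (sz i) i i = \mxdiag_k ((k == i)%:R *: 1%:M).
  apply: eq_mxblock => x y; have [<-|neq_xy] := eqVneq x y.
    rewrite conform_mx_id andbb; case: eqVneq => [->|_]; last by rewrite !scale0r.
    by rewrite pid_mx_1.
  by case: eqVneq => [<-|_]; rewrite /= ?scale0r // eq_sym (negPf neq_xy) scale0r.
apply/mxblockP => x y; rewrite unitE mul_mxdiag_mxblock submxblockZ !mxblockK.
rewrite -scalemxAl mul1mx; case: (eqVneq x j) => [->|_] /=.
  by rewrite eq_sym.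
by rewrite scale0r !scaler0.
Qed.

Lemma mul_corner_jordan_unit i j k :
  i != k -> jordan_corner j k *m jordan_unit (sz i) i i = 0.
Proof.
move=> neq_ik; rewrite mul_mxblock -[RHS]mxblock0; apply: eq_mxblock => x y.
rewrite big1 // => z _; case: (eqVneq z k) => [->|_].
  by rewrite [k == i]eq_sym (negPf neq_ik) scale0r mulmx0.
by rewrite andbF scale0r mul0mx.
Qed.

(** The rows of the nonzero matrix [jordan_corner i i] lie in the eigenspace of [ev i]. *)
Lemma eigenvalue_jordan_mx i : (0 < sz i)%N -> eigenvalue J (ev i).
Proof.
move=> sz_gt0; apply: contraNN (jordan_corner_neq0 sz_gt0 sz_gt0) => /eqP eig0.
by rewrite -submx0 -eig0; apply/eigenspaceP; rewrite mul_corner_jordan_mx.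
Qed.

End JordanMxCommutant.

(** * Conjugation by an invertible matrix *)

Section UnitConjugation.
Variables (F : fieldType) (n : nat) (P : 'M[F]_n).
Hypothesis uP : P \in unitmx.

Lemma conjumxM A B : conjmx P (A *m B) = conjmx P A *m conjmx P B.
Proof. by apply: conjmxM; rewrite inE stablemx_unit. Qed.

Lemma conjumxZ c A : conjmx P (c *: A) = c *: conjmx P A.
Proof. by rewrite /conjmx -scalemxAr -scalemxAl. Qed.

Lemma conjumx_eq0 A : (conjmx P A == 0) = (A == 0).
Proof.
by rewrite -(inj_eq (can_inj (fun X => conjmxK X uP))) conjmx0.
Qed.

Lemma comm_conjumx A B : comm_mx A B -> comm_mx (conjmx P A) (conjmx P B).
Proof. by rewrite /comm_mx -!conjumxM => ->. Qed.

End UnitConjugation.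

(** * Properties of centralizers *)

Section Centralizer.
Variables (F : fieldType) (n : nat) (T : 'M[F]_n).
Local Notation C := (GL_centralizer T).

Definition centralizer_mx (x : C) : 'M[F]_n := GL_mx (val x).
Local Notation mx := centralizer_mx.

Lemma centralizer_mx_inj : injective mx.
Proof. by move=> x y /val_inj/val_inj. Qed.

Lemma centralizer_mx_comm x : comm_mx T (mx x).
Proof. exact/esym/eqP/(valP x). Qed.

Lemma centralizer_mx1 : mx 1%g = 1%:M. Proof. by []. Qed.

Lemma centralizer_mxM x y : mx (x * y)%g = mx x *m mx y. Proof. by []. Qed.

Lemma centralizer_mxP A :
  A \in unitmx -> comm_mx T A -> exists x, mx x = A.
Proof.
move=> uA cA; have cA' : GL_commutes T (MkGL uA) by apply/eqP.
by exists (Sub (MkGL uA) cA'); rewrite /centralizer_mx SubK.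
Qed.

Lemma centralizer_abelian :
  (forall X Y, comm_mx T X -> comm_mx T Y -> comm_mx X Y) -> is_abelian C.
Proof.
move=> commT x y; apply: centralizer_mx_inj.
exact: commT (centralizer_mx_comm x) (centralizer_mx_comm y).
Qed.

(** On the image of [E], 1 + cE is multiplication by c + 1, so it is invertible; 1 + Z is invertible
    because Z^2 = Z(EZ) = (ZE)Z = 0. Their two products differ by cZ. *)
Lemma idempotent_centralizer_not_abelian (c : F) E Z :
  c != 0 -> c + 1 != 0 ->
  comm_mx T E -> comm_mx T Z -> E *m E = E ->
  E *m Z = Z -> Z *m E = 0 -> Z != 0 -> ~ is_abelian C.
Proof.
move=> c0 c1 cE cZ EE EZ ZE nzZ abC.
have ZZ : Z *m Z = 0 by rewrite -{2}EZ mulmxA ZE mul0mx.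
have uZ : 1%:M + Z \in unitmx.
  suff /mulmx1_unit[] : (1%:M + Z) *m (1%:M - Z) = 1%:M by [].
  by rewrite mulmxBr mulmx1 mulmxDl mul1mx ZZ addr0 addrK.
have uE : 1%:M + c *: E \in unitmx.
  suff /mulmx1_unit[] :
    (1%:M + c *: E) *m (1%:M - (c / (c + 1)) *: E) = 1%:M by [].
  rewrite mulmxBr mulmx1 mulmxDl mul1mx -scalemxAr -scalemxAl EE.
  rewrite scalerA -scalerDl -addrA -scalerBl.
  suff -> : c - (c / (c + 1) + c / (c + 1) * c) = 0 by rewrite scale0r addr0.
  by rewrite -{1}[c / _]mulr1 -mulrDr [1 + c]addrC divfK // subrr.
have [x xE] := centralizer_mxP uZ (comm_mxD (comm_mx1 _) cZ).
have [y yE] := centralizer_mxP uE (comm_mxD (comm_mx1 _) (comm_mxZ c cE)).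
move/(congr1 mx): (abC x y); rewrite !centralizer_mxM xE yE.
rewrite !mulmxDl !mulmxDr !mulmx1 !mul1mx -scalemxAl -scalemxAr EZ ZE scaler0.
rewrite addr0 [RHS]addrA [LHS]addrAC -[LHS]addr0 => /addrI/esym/eqP.
by rewrite scaler_eq0 (negPf c0) (negPf nzZ).
Qed.

(** * Solvability from a weight *)

Section Solvable.
Variables (P : 'M[F]_n) (w : 'I_n -> nat).
Hypothesis uP : P \in unitmx.
(* In the basis given by P, an ordering by w makes the commutant of T triangular. *)
Hypothesis cT_weight : forall X p q,
  comm_mx T X -> conjmx P X p q != 0 -> p = q \/ (w p < w q)%N.

Definition raises_weight k (M : 'M[F]_n) :=
  forall p q, (w q < w p + k)%N -> M p q = 0.

(** In a nonzero term M_ps N_sq the weight rises by at least [i], then by at least [j]. *)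
Lemma raises_weightM i j M N :
  raises_weight i M -> raises_weight j N -> raises_weight (i + j) (M *m N).
Proof.
move=> rM rN p q lt_qp; rewrite mxE big1 // => s _.
have [lt_sp|le_ps] := ltnP (w s) (w p + i); first by rewrite rM ?mul0r.
by rewrite rN ?mulr0 //; lia.
Qed.

Lemma raises_weightD k M N :
  raises_weight k M -> raises_weight k N -> raises_weight k (M + N).
Proof. by move=> rM rN p q lt_qp; rewrite mxE rM ?rN ?addr0. Qed.

Lemma raises_weightN k M : raises_weight k M -> raises_weight k (- M).
Proof. by move=> rM p q lt_qp; rewrite mxE rM ?oppr0. Qed.

Lemma raises_weightW i j M :
  (i <= j)%N -> raises_weight j M -> raises_weight i M.
Proof. by move=> le_ij rM p q lt_qp; apply: rM; lia. Qed.

Local Notation phi x := (conjmx P (mx x)).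

Lemma conj_centralizer1 : phi 1%g = 1%:M.
Proof. by rewrite centralizer_mx1 conjmx_scalar ?row_free_unit. Qed.

Lemma conj_centralizerM x y : phi (x * y)%g = phi x *m phi y.
Proof. by rewrite centralizer_mxM (conjumxM uP). Qed.

Lemma conj_centralizer_weight x : raises_weight 0 (phi x).
Proof.
move=> p q; rewrite addn0 => lt_qp; apply/eqP/negPn/negP.
by case/(cT_weight (centralizer_mx_comm x)) => [pq|]; [subst q|]; lia.
Qed.

(** Level 0 is the whole centralizer, and from level 1 on the elements are unipotent. *)
Definition congruence k (x : C) := raises_weight k (phi x - 1%:M).

Lemma congruence_subgroup k : is_subgroup (congruence k).
Proof.
split=> [|x y cx cy|x cx]; rewrite /congruence.
- by rewrite conj_centralizer1 subrr => p q _; rewrite mxE.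
- have -> : phi (x * y)%g - 1%:M = (phi x - 1%:M) *m phi y + (phi y - 1%:M).
    by rewrite conj_centralizerM mulmxBl mul1mx addrA subrK.
  apply: raises_weightD => //; rewrite -[k]addn0.
  exact/raises_weightM/conj_centralizer_weight.
have -> : phi x^-1%g - 1%:M = - (phi x^-1%g *m (phi x - 1%:M)).
  by rewrite mulmxBr -conj_centralizerM mulVg conj_centralizer1 mulmx1 opprB.
by apply: raises_weightN; apply: raises_weightM (conj_centralizer_weight _) cx.
Qed.

Let mxBE (A B : 'M[F]_n) p q : (A - B) p q = A p q - B p q.
Proof. by rewrite !mxE. Qed.

(** This reduces group commutators to additive ones, since the factor on the left does not lower the
    weight. *)
Lemma conj_centralizer_commg x y :
  phi [~ x, y]%g - 1%:M =
  phi (x^-1 * y^-1)%g *m (phi x *m phi y - phi y *m phi x).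
Proof.
rewrite mulmxBr -!conj_centralizerM; congr (phi _ - _).
  by rewrite commgEl conjgE !mulgA.
by rewrite -mulgA mulKg mulVg conj_centralizer1.
Qed.

(** For positive [k], the additive commutator of x and y is that of x - 1 and y - 1, which raises
    the weight by 2k, at least k + 1. At level 0 this gains nothing; there the diagonal entries
    multiply commutatively. *)
Lemma congruence_commg k x y :
  congruence k x -> congruence k y -> congruence k.+1 [~ x, y]%g.
Proof.
rewrite /congruence conj_centralizer_commg -[k.+1]add0n => cx cy.
apply: raises_weightM; first exact: conj_centralizer_weight.
case: k cx cy => [_ _|k cx cy].
  move=> p q; rewrite addn1 ltnS leq_eqVlt => /orP[/eqP eq_w|lt_w]; last first.
    by rewrite -!conj_centralizerM mxBE !conj_centralizer_weight ?subr0 // addn0.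
  (* As [p] and [q] have equal weight, a product of entries through any s other than [p] would have
     to raise the weight and then lower it. *)
  have diagM u v : (phi u *m phi v) p q = (p == q)%:R * (phi u p p * phi v p p).
    rewrite mxE (bigD1 p) //= big1 => [|s neq_sp].
      rewrite addr0; case: eqVneq => [<-|neq_pq]; first by rewrite mul1r.
      rewrite mul0r; apply/eqP; rewrite mulf_eq0 orbC.
      apply: contraNT neq_pq; rewrite negb_or => /andP[nz_pq _]; apply/eqP.
      by case/(cT_weight (centralizer_mx_comm v)): nz_pq; rewrite // eq_w ltnn.
    apply/eqP; rewrite mulf_eq0; apply: contraNT neq_sp; rewrite negb_or.
    case/andP => /(cT_weight (centralizer_mx_comm u))[->//|lt_ps].
    by rewrite conj_centralizer_weight ?eqxx // addn0 eq_w.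
  by rewrite mxBE !diagM [phi y p p * _]mulrC subrr.
have subrBB (A B D : 'M[F]_n) : (A - D) - (B - D) = A - B.
  by rewrite opprB addrA subrK.
have subM1 (A B : 'M[F]_n) :
    (A - 1%:M) *m (B - 1%:M) = A *m B - (A + B - 1%:M).
  by rewrite mulmxBr mulmxBl mulmxBl !mulmx1 !mul1mx -addrA -opprD addrCA addrA.
have -> : phi x *m phi y - phi y *m phi x =
   (phi x - 1%:M) *m (phi y - 1%:M) - (phi y - 1%:M) *m (phi x - 1%:M).
  by rewrite !subM1 [phi y + phi x]addrC subrBB.
apply: (@raises_weightW _ (k.+1 + k.+1)); first by lia.
by apply: raises_weightD; [|apply: raises_weightN]; apply: raises_weightM.
Qed.

Lemma derived_series_congruence k x : derived_series k x -> congruence k x.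
Proof.
elim: k x => [|k IHk] x /= Dx.
  apply: raises_weightD; first exact: conj_centralizer_weight.
  apply: raises_weightN; rewrite -conj_centralizer1; exact: conj_centralizer_weight.
(* [Dx] ranges over all subgroups containing the commutators; it is applied to the next congruence
   subgroup. *)
apply: Dx; first exact: congruence_subgroup.
by move=> _ [y [z [/IHk cy /IHk cz ->]]]; apply: congruence_commg.
Qed.

Lemma weighted_centralizer_solvable : is_solvable C.
Proof.
(* No entry can raise the weight by more than the maximal weight, so x - 1 vanishes at this
   level. *)
exists (\max_p w p).+1 => x /derived_series_congruence cx.
apply: centralizer_mx_inj; rewrite -[LHS](conjmxK _ uP) -[RHS](conjmxK _ uP).
congr (conjmx _ _); rewrite conj_centralizer1; apply/eqP; rewrite -subr_eq0; apply/eqP.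
apply/matrixP => p q; rewrite cx ?mxE //.
by rewrite addnS ltnS (leq_trans (leq_bigmax q)) ?leq_addl.
Qed.

End Solvable.

(** * General linear groups from matrix units *)

Section MatrixUnits.
Variables (k : nat) (E : 'I_k -> 'I_k -> 'M[F]_n).
Hypothesis cE : forall a b, comm_mx T (E a b).
Hypothesis mulE : forall a b c d, E a b *m E c d = (b == c)%:R *: E a d.
Hypothesis nzE : forall a, E a a != 0.

Definition mx_of_units (g : 'M[F]_k) := \sum_a \sum_b g a b *: E a b.
Local Notation S := mx_of_units.

Lemma mx_of_units0 : S 0 = 0.
Proof. by apply: big1 => a _; apply: big1 => b _; rewrite mxE scale0r. Qed.

Lemma mx_of_unitsD g h : S (g + h) = S g + S h.
Proof.
rewrite -big_split; apply: eq_bigr => a _; rewrite -big_split.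
by apply: eq_bigr => b _; rewrite mxE scalerDl.
Qed.

Lemma unit_mul_mx_of_units d a g : E d a *m S g = \sum_b g a b *: E d b.
Proof.
rewrite mulmx_sumr (bigD1 a) //= [X in _ + X]big1 => [|c neq_ca].
  rewrite addr0 mulmx_sumr; apply: eq_bigr => b _.
  by rewrite -scalemxAr mulE eqxx scale1r.
rewrite mulmx_sumr big1 // => b _.
by rewrite -scalemxAr mulE eq_sym (negPf neq_ca) scale0r scaler0.
Qed.

Lemma mx_of_unitsM g h : S (g *m h) = S g *m S h.
Proof.
rewrite mulmx_suml; apply: eq_bigr => a _; rewrite mulmx_suml.
transitivity (\sum_b \sum_c (g a c * h c b) *: E a b).
  by apply: eq_bigr => b _; rewrite mxE scaler_suml.
rewrite exchange_big; apply: eq_bigr => c _ /=.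
rewrite -scalemxAl unit_mul_mx_of_units scaler_sumr.
by apply: eq_bigr => b _; rewrite scalerA.
Qed.

Lemma mx_of_units_inj : injective S.
Proof.
move=> g h eqS; apply/matrixP => a b.
(* Multiplying by units on both sides isolates one coefficient, which is recovered because [E a a]
   is nonzero. *)
have coefE f : E a a *m S f *m E b a = f a b *: E a a.
  rewrite unit_mul_mx_of_units mulmx_suml (bigD1 b) //= big1 => [|c neq_cb].
    by rewrite -scalemxAl mulE eqxx scale1r addr0.
  by rewrite -scalemxAl mulE (negPf neq_cb) scale0r scaler0.
apply/eqP; rewrite -subr_eq0; have := coefE g; rewrite eqS coefE => /eqP.
rewrite eq_sym -subr_eq0 -scalerBl scaler_eq0 (negPf (nzE a)).
by rewrite orbF.
Qed.

(* S is multiplicative but does not map 1 to 1; this is its unital extension. *)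
Definition GL_mx_of_units (g : 'M[F]_k) := 1%:M + S (g - 1%:M).
Local Notation G := GL_mx_of_units.

Lemma GL_mx_of_units1 : G 1%:M = 1%:M.
Proof. by rewrite /G subrr mx_of_units0 addr0. Qed.

Lemma GL_mx_of_unitsM g h : G (g *m h) = G g *m G h.
Proof.
rewrite mulmxDl mul1mx mulmxDr mulmx1 -mx_of_unitsM -addrA -!mx_of_unitsD.
(* What remains is gh - 1 = (h - 1) + (g - 1) + (g - 1)(h - 1). *)
congr (_ + S _); rewrite mulmxBl mulmxBr mulmx1 mul1mx.
by rewrite addrCA subrKC [RHS]addrC addrA subrK.
Qed.

Lemma GL_mx_of_units_inj : injective G.
Proof. by move=> g h /addrI/mx_of_units_inj/addIr. Qed.

Lemma comm_GL_mx_of_units g : comm_mx T (G g).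
Proof.
apply: comm_mxD; first exact: comm_mx1.
by apply: comm_mx_sum => a _; apply: comm_mx_sum => b _; apply/comm_mxZ/cE.
Qed.

Lemma GL_mx_of_units_unit (g : GL F k) : G g \in unitmx.
Proof.
have /mulmx1_unit[] // : G g *m G (invmx g) = 1%:M.
by rewrite -GL_mx_of_unitsM (mulmxV (Defs.GL_unit g)) GL_mx_of_units1.
Qed.

Fact GL_of_units_comm (g : GL F k) : GL_commutes T (MkGL (GL_mx_of_units_unit g)).
Proof. exact/eqP/comm_mx_sym/comm_GL_mx_of_units. Qed.

Definition GL_of_units (g : GL F k) : C := Sub _ (GL_of_units_comm g).

Lemma GL_of_unitsM : {morph GL_of_units : g h / (g * h)%g}.
Proof.
by move=> g h; apply: centralizer_mx_inj; rewrite /mx /= GL_mx_of_unitsM.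
Qed.

HB.instance Definition _ :=
  isMultiplicative.Build (GL F k) C GL_of_units GL_of_unitsM.

Lemma matrix_units_contains_GL : contains_copy C (GL F k).
Proof.
exists (fun y => exists g, GL_of_units g = y).
  split=> [|_ _ [g <-] [h <-]|_ [g <-]].
  - exists 1%g; apply: centralizer_mx_inj; exact: GL_mx_of_units1.
  - by exists (g * h)%g; rewrite gmulfM.
  exists g^-1%g; apply/(mulIg (GL_of_units g)).
  rewrite -gmulfM !mulVg; apply: centralizer_mx_inj; exact: GL_mx_of_units1.
exists GL_of_units; split=> // g h /(congr1 mx).
by move=> /GL_mx_of_units_inj/val_inj.
Qed.

End MatrixUnits.

End Centralizer.

(** * Matrices similar to a Jordan matrix *)

Section SimilarToJordan.
Variables (L : closedFieldType) (r : nat) (ev : 'I_r -> L) (sz : 'I_r -> nat).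
Local Notation N := (\sum_(i < r) sz i)%N.
Local Notation J := (jordan_mx ev sz).
Hypothesis sz_gt0 : forall i, (0 < sz i)%N.
Variables (A P : 'M[L]_N).
Hypotheses (uP : P \in unitmx) (AE : A = conjmx (invmx P) J).

Let uPV : invmx P \in unitmx. Proof. by rewrite unitmx_inv. Qed.

Let JE : J = conjmx P A. Proof. by rewrite AE conjmxVK. Qed.

Lemma eigenvalue_similar_jordan i : eigenvalue A (ev i).
Proof.
have : ev i \in eigenvalue (conjmx P A).
  by rewrite -JE; apply: eigenvalue_jordan_mx.
by apply: eigenvalue_conjmx; rewrite ?stablemx_unit ?row_free_unit.
Qed.

Lemma distinct_eigenvalues_abelian :
  (forall a, eigenvalue A a -> exists! i, ev i = a) ->
  is_abelian (GL_centralizer A).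
Proof.
move=> ev_uniq; have ev_inj : injective ev.
  move=> i j eq_ev; have [k [_ kE]] := ev_uniq _ (eigenvalue_similar_jordan i).
  by rewrite -(kE i) // -(kE j).
apply: centralizer_abelian => X Y cX cY.
rewrite -[X](conjmxK _ uP) -[Y](conjmxK _ uP); apply: comm_conjumx => //.
by apply: (comm_comm_jordan_mx ev_inj); rewrite JE; apply: comm_conjumx.
Qed.

Lemma equal_blocks_contains_GL2 i j :
  i != j -> ev i = ev j -> sz i = sz j ->
  contains_copy (GL_centralizer A) (GL L 2).
Proof.
move=> neq_ij eq_ev eq_sz; pose f (a : 'I_2) := if a == 0%N :> nat then i else j.
have f_inj a b : (f a == f b) = (a == b).
  rewrite -[RHS]val_eqE /f; case: a b => [[|[|a]] lta] [[|[|b]] ltb] //=.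
  - by rewrite eqxx.
  - exact: negPf.
  - by rewrite eq_sym; apply: negPf.
  by rewrite eqxx.
have evf a : ev (f a) = ev i by rewrite /f; case: ifP.
have szf a : sz (f a) = sz i by rewrite /f; case: ifP.
pose E a b := conjmx (invmx P) (jordan_unit L sz (sz i) (f a) (f b)).
apply: (matrix_units_contains_GL (E := E)) => [a b|a b c d|a].
- by rewrite AE; apply/comm_conjumx/comm_jordan_unit; rewrite ?evf.
- by rewrite -conjumxM // mul_jordan_unit // f_inj conjumxZ.
by rewrite conjumx_eq0 // jordan_unit_neq0.
Qed.

Lemma two_blocks_not_abelian i j :
  i != j -> ev i = ev j -> ~ is_abelian (GL_centralizer A).
Proof.
move=> neq_ij eq_ev.
(* A root of X^2 + X + 1 is a scalar other than 0 and -1 in every characteristic. *)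
have [c cE] := @solve_monicpoly L 2 (fun=> -1) isT.
have {}cE : c ^+ 2 + c + 1 = 0.
  rewrite cE !big_ord_recl big_ord0 expr0 expr1 !mulN1r addr0 -opprD.
  by rewrite -addrA [c + 1]addrC addNr.
apply: (@idempotent_centralizer_not_abelian _ _ A c
  (conjmx (invmx P) (jordan_unit L sz (sz i) i i))
  (conjmx (invmx P) (jordan_corner L sz i j))).
- by apply: contra_eq_neq cE => ->; rewrite expr0n mulr0n !add0r oner_neq0.
- apply: contra_eq_neq cE => c1; rewrite -addrA c1 addr0 expf_neq0 //.
  by apply: contra_eq_neq c1 => ->; rewrite add0r oner_neq0.
- by rewrite AE; apply/comm_conjumx/comm_jordan_unit.
- rewrite AE; apply/comm_conjumx => //.
  by rewrite /comm_mx mul_jordan_mx_corner mul_corner_jordan_mx eq_ev.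
- by rewrite -conjumxM // mul_jordan_unit // eqxx scale1r.
- by rewrite -conjumxM // mul_jordan_unit_corner eqxx scale1r.
- by rewrite -conjumxM // mul_corner_jordan_unit // conjmx0.
by rewrite conjumx_eq0 // jordan_corner_neq0.
Qed.

Lemma distinct_sizes_solvable :
  (forall i j, i != j -> ev i = ev j -> sz i <> sz j) ->
  is_solvable (GL_centralizer A).
Proof.
move=> neq_sz.
apply: (@weighted_centralizer_solvable _ _ A P (@jordan_weight r sz)) => //.
move=> X p q cX; apply: (comm_jordan_mx_weight neq_sz).
by rewrite JE; apply: comm_conjumx.
Qed.

End SimilarToJordan.

Theorem theorem2p2 (K : fieldType) (L : closedFieldType)
    (iota : {rmorphism K -> L}) (L_alg : forall x : L, algebraicOver iota x)
    (n : nat) (n_gt0 : (0 < n)%N) (T : GL K n)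
    (TL : 'M[L]_n) (TL_def : TL = map_mx iota T)
    (r : nat) (ev : 'I_r -> L) (sz : 'I_r -> nat)
    (TL_jordan : jordan_form TL ev sz) :
  [/\ (forall a, eigenvalue TL a -> exists! i, ev i = a) ->
        is_abelian (GL_centralizer TL),
      (exists a, eigenvalue TL a /\
         exists i j, [/\ i != j, ev i = a, ev j = a & sz i = sz j]) ->
        contains_copy (GL_centralizer TL) (GL L 2)
    & (forall a, eigenvalue TL a ->
         forall i j, i != j -> ev i = a -> ev j = a -> sz i <> sz j) ->
      (exists a, eigenvalue TL a /\
         exists i j, [/\ i != j, ev i = a & ev j = a]) ->
        ~ is_abelian (GL_centralizer TL) /\ is_solvable (GL_centralizer TL)].
Proof.
case: TL_jordan => sz_gt0 [e [P uP]] /(similarLR uP).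
move: TL P uP {TL_def T n_gt0}; case: _ / e => TL P uP; rewrite castmx_id => TLE.
split.
- exact: distinct_eigenvalues_abelian TLE.
- move=> [a [_ [i [j [neq_ij evi evj eq_sz]]]]].
  by apply: (equal_blocks_contains_GL2 _ uP TLE neq_ij); rewrite ?evi.
move=> neq_sz [a [_ [i [j [neq_ij evi evj]]]]]; split.
  by apply: (two_blocks_not_abelian _ uP TLE neq_ij); rewrite ?evi.
(* The hypothesis on sizes speaks of eigenvalues of the matrix, and every [ev k] is one because its
   block is nonempty. *)
apply: (distinct_sizes_solvable uP TLE) => k l neq_kl eq_ev.
exact: neq_sz (eigenvalue_similar_jordan sz_gt0 uP TLE k) _ _ neq_kl _ _.
Qed.
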